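(* Let $X$ be a complex Hilbert space and let $T\colon X\to X$ be an invertible bounded linear operator. Then $T$ has the shadowing property if and only if its adjoint operator $T^*$ is uniformly expansive, i.e., $$\sigma_a(T^* )\cap\mathbb T=\emptyset,$$ where $\sigma_a(T^* )$ is the approximate point spectrum of $T^*$ and $\mathbb T=\{\lambda\in\mathbb C : |\lambda|=1\}$ is the unit circle.
   Context: $L(X)$ denotes the space of bounded linear operators on $X$, with identity operator $I$, and $S(X)=\{x\in X : \|x\|=1\}$. An operator $T\in L(X)$ is invertible if there exists $S\in L(X)$ with $ST=TS=I$. The adjoint $T^*\in L(X)$ is the Hilbert space adjoint, i.e. the unique operator with $\langle Tx,y\rangle=\langle x,T^*y\rangle$ for all $x,y\in X$. For $\delta>0$, a $\delta$-pseudotrajectory of an invertible $T\in L(X)$ is a sequence $(x_n)_{n\in\mathbb Z}$ in $X$ such that $\|x_{n+1}-Tx_n\|\le\delta$ for all $n\in\mathbb Z$. The operator $T$ has the shadowing property if for every $\epsilon>0$ there exists $\delta>0$ such that for every $\delta$-pseudotrajectory $(x_n)_{n\in\mathbb Z}$ of $T$ there exists $x\in X$ with $\|x_n-T^nx\|\le\epsilon$ for all $n\in\mathbb Z$. An invertible operator $T\in L(X)$ is uniformly expansive if there exists a positive integer $n$ such that, for every $x\in S(X)$, $\|T^nx\|\ge 2$ or $\|T^{-n}x\|\ge 2$. An operator $T\in L(X)$ is bounded below if there exists $\alpha>0$ such that $\|Tx\|\ge\alpha\|x\|$ for all $x\in X$. The spectrum of $T$ is $\sigma(T)=\{\lambda\in\mathbb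 C : \lambda I-T\text{ is not invertible}\}$ and the approximate point spectrum is $\sigma_a(T)=\{\lambda\in\sigma(T) : \lambda I-T\text{ is not bounded below}\}$. The ''i.e.'' in the claim refers to the known fact that an invertible operator on a complex Banach space is uniformly expansive if and only if its approximate point spectrum is disjoint from $\mathbb T$; thus the claim asserts that the shadowing property of $T$, the uniform expansivity of $T^*$, and $\sigma_a(T^* )\cap\mathbb T=\emptyset$ are equivalent. *)

(* Defs.v *)
From HB Require Import structures.
From mathcomp Require Import all_boot all_order all_algebra.
From mathcomp Require Export complex.
From mathcomp Require Import all_classical all_reals all_analysis.
Set Implicit Arguments.
Unset Strict Implicit.
Unset Printing Implicit Defensive.
Import Order.TTheory GRing.Theory Num.Theory.
Import numFieldNormedType.Exports.
Local Open Scope classical_set_scope.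
Local Open Scope ring_scope.

(* An inequality [a <= b] in [C] asserts in particular that [b - a] is real,
   and [0 < e] that [e] is real; norms are real elements of [C]. *)
Section Operators.
Context {C : numFieldType} {X : normedModType C}.
Implicit Types (T S : X -> X) (x y : X).

(* Membership in L(X). *)
Definition bounded_operator T : Prop :=
  linear T /\ exists M : C, forall x, `|T x| <= M * `|x|.

Definition invertible T : Prop :=
  exists S, [/\ bounded_operator S, cancel T S & cancel S T].

(* [opinv T] is the inverse of [T] when [T] is bijective; when it is not, this
   is a total function with no meaning. *)
Definition opinv T : X -> X := 'pinv_(fun=> 0) setT T.

(* [opow T n] is T^n for n in Z (meaningful when [T] is invertible). *)
Definition opow T (n : int) : X -> X :=
  match n with
  | Posz k => iter k T
  | Negz k => iter k.+1 (opinv T)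
  end.

Definition pseudotrajectory T (delta : C) (x : int -> X) : Prop :=
  forall n : int, `|x (n + 1) - T (x n)| <= delta.

Definition shadowing_property T : Prop :=
  forall eps : C, 0 < eps -> exists2 delta : C, 0 < delta &
    forall x : int -> X, pseudotrajectory T delta x ->
      exists y : X, forall n : int, `|x n - opow T n y| <= eps.

Definition uniformly_expansive T : Prop :=
  invertible T /\
  exists2 n : nat, (0 < n)%N &
    forall x, `|x| = 1 ->
      2 <= `|opow T n%:Z x| \/ 2 <= `|opow T (- n%:Z) x|.

Definition bounded_below T : Prop :=
  exists2 alpha : C, 0 < alpha & forall x, alpha * `|x| <= `|T x|.

Definition spectrum T : set C :=
  [set lambda | ~ invertible (fun x => lambda *: x - T x)].

Definition approx_point_spectrum T : set C :=
  [set lambda | spectrum T lambda /\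
                ~ bounded_below (fun x => lambda *: x - T x)].

End Operators.

Definition unit_circle (C : numFieldType) : set C := [set lambda | `|lambda| = 1].

(* With [X] a complete normed module, this makes [X] a Hilbert space with inner
   product [ip]; [ip] is linear in its first argument and conjugate-linear in
   its second one. *)
Definition norm_from_inner_product (C : numClosedFieldType)
    (X : normedModType C) (ip : {dot X for (@Num.conj C)}) : Prop :=
  forall x : X, `|x| ^+ 2 = ip x x.

(* [adjoint ip T y] is the vector z such that <T x, y> = <x, z> for all x. It is
   unique since [ip] is positive definite; for a bounded operator [T] on a
   Hilbert space it exists by the Riesz representation theorem (the default
   value 0 is then irrelevant). *)
Definition adjoint (C : numClosedFieldType) (X : normedModType C)
    (ip : {dot X for (@Num.conj C)}) (T : X -> X) (y : X) : X :=
  xget 0 [set z | forall x : X, ip (T x) y = ip x z].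

(* Main.v *)
(** Write S for the adjoint of T; all three properties are equivalent to
    [l - S] being bounded below for every l on the unit circle, uniformly in l
    by compactness.

    Discrete Fourier transform on N-periodic sequences turns this uniform bound
    c into [c^2 sum |y_i|^2 <= sum |y_(i+1) - S y_i|^2].  Applied to the orbit
    [S^n x] cut off to [|n| < m], it says that [|S^m x|^2 + |S^-m x|^2]
    dominates a fixed multiple of the sum of the previous [|S^n x|^2], hence
    grows exponentially: S is uniformly expansive.

    For shadowing one must solve [A u = z] with u bounded, where
    [(A u)_n = u_(n+1) - T u_n].  The adjoint B of A on l^2 is bounded below by
    the Fourier estimate, so the Richardson step [Q = 1 - t A B] contracts
    periodic l^2 by some q < 1.  As Q has range 1, [(Q^k z)_n] only sees the
    2k+1 entries of z around n, so [|(Q^k z)_n|^2 <= (2k+1) q^k sup |z|^2] for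
    bounded z, and [u = sum_k t B Q^k z] converges to a bounded solution.

    Conversely, if [S y] is close to [l y] for a unit vector y, then the
    pseudotrajectory driven by [delta l^-(n+1) y] drifts linearly away from
    every orbit in the direction of [l^-n y], which contradicts shadowing. *)

Require Import Defs.
From HB Require Import structures.
From mathcomp Require Import all_boot all_order all_algebra complex.
From mathcomp Require Import all_classical all_reals all_analysis.
From mathcomp Require Import zify ring lra.
Import Order.TTheory GRing.Theory Num.Theory.
Import numFieldNormedType.Exports.
Local Open Scope classical_set_scope.
Local Open Scope ring_scope.

Local Open Scope complex_scope.

(** * Real-valued norms and Cauchy sequences with a rate *)

Section RealNorm.
Context {R : realType} {X : completeNormedModType R[i]}.
Implicit Types (x y z : X) (a : R[i]) (r : R).

(** Norms lie in [R[i]], whose order is partial; being real, they lose nothing when replaced by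
    their real part, where the order is total. *)
Definition rnorm x : R := complex.Re `|x|.

Lemma rnormE x : `|x| = (rnorm x)%:C.
Proof. by rewrite /rnorm RRe_real // normr_real. Qed.

Lemma rnorm_ge0 x : 0 <= rnorm x.
Proof. by rewrite -lecR -rnormE normr_ge0. Qed.

Lemma rnorm0_eq0 x : rnorm x = 0 -> x = 0.
Proof. by move=> x0; apply/eqP; rewrite -normr_eq0 rnormE x0. Qed.

Lemma rnorm0 : rnorm 0 = 0.
Proof. by rewrite /rnorm normr0. Qed.

Lemma rnormN x : rnorm (- x) = rnorm x.
Proof. by rewrite /rnorm normrN. Qed.

Lemma rnormD x y : rnorm (x + y) <= rnorm x + rnorm y.
Proof. by rewrite -lecR rmorphD /= -!rnormE ler_normD. Qed.

Lemma rnormB x y : rnorm (x - y) <= rnorm x + rnorm y.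
Proof. by rewrite -(rnormN y) rnormD. Qed.

Lemma rnorm_sum (I : Type) (s : seq I) (F : I -> X) :
  rnorm (\sum_(i <- s) F i) <= \sum_(i <- s) rnorm (F i).
Proof.
elim: s => [|i s IH]; first by rewrite !big_nil rnorm0.
by rewrite !big_cons (le_trans (rnormD _ _)) // lerD2l.
Qed.

Lemma rnormZ a x : rnorm (a *: x) = complex.Re `|a| * rnorm x.
Proof.
have aE : (complex.Re `|a|)%:C = `|a| by rewrite RRe_real ?normr_real.
by rewrite {1}/rnorm normrZ rnormE -aE -rmorphM.
Qed.

Lemma rnormZ1 a x : `|a| = 1 -> rnorm (a *: x) = rnorm x.
Proof. by move=> a1; rewrite rnormZ a1 mul1r. Qed.

Lemma rnormZr r x : rnorm (r%:C *: x) = `|r| * rnorm x.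
Proof. by rewrite rnormZ normc_def /= expr0n addr0 sqrtr_sqr. Qed.

Lemma cauchy_rate (u : nat -> X) (e : nat -> R) :
    (forall n m, (n <= m)%N -> rnorm (u m - u n) <= e n) ->
    (forall eps, 0 < eps -> exists n, e n < eps) ->
  exists l, forall n, rnorm (l - u n) <= e n.
Proof.
move=> ue e0.
have e_lt a : 0 < a -> exists n, (e n)%:C < a.
  move=> a0; have aE : (complex.Re a)%:C = a by rewrite RRe_real ?gtr0_real.
  have [n en] : exists n, e n < complex.Re a by apply: e0; rewrite -ltcR aE.
  by exists n; rewrite -aE ltcR.
have /cauchy_cvgP/cvg_ex[l ul] : cauchy (u @ \oo).
  apply: cauchy_exP => a /e_lt[n en]; exists (u n).
  exists n => // m /= nm.
  rewrite -ball_normE /= distrC rnormE (le_lt_trans _ en) // lecR.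
  exact: ue.
exists l => n; apply/ler_addgt0Pr => eps eps0.
have eps0C : 0 < eps%:C :> R[i] by rewrite (_ : 0 = 0%:C) // ltcR.
(* An index beyond both [n] and [N] is within [eps] of the limit and within [e n] of [u n]. *)
have [N _ NP] := (cvgrPdist_le u l).1 ul _ eps0C.
have := NP (maxn n N) (leq_maxr _ _); rewrite rnormE lecR => lN.
have -> : l - u n = (l - u (maxn n N)) + (u (maxn n N) - u n).
  by rewrite addrA subrK.
by rewrite addrC (le_trans (rnormD _ _)) // lerD // ue // leq_maxl.
Qed.

End RealNorm.

(** * Geometric sequences and series *)

Section GeometricSeries.
Context {R : realType}.
Implicit Types (r C : R).

Lemma geometric_small r C : 0 <= r < 1 ->
  forall eps, 0 < eps -> exists n, C * r ^+ n < eps.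
Proof.
move=> /andP[r0 r1] eps eps0.
have : (fun n => C * r ^+ n) @ \oo --> (0 : R).
  rewrite -[X in _ --> X](mulr0 C); apply: cvgM; first exact: cvg_cst.
  by apply: cvg_expr; rewrite ger0_norm.
move=> /cvgrPdist_lt /(_ _ eps0) [N _ /(_ N (leqnn _))].
rewrite sub0r normrN => h; exists N.
exact: le_lt_trans (ler_norm _) h.
Qed.

Lemma geometric_tail r n k : 0 <= r < 1 ->
  \sum_(n <= i < n + k) r ^+ i <= r ^+ n / (1 - r).
Proof.
move=> /andP[r0 r1]; rewrite ler_pdivlMr ?subr_gt0 //.
have -> : (\sum_(n <= i < n + k) r ^+ i) * (1 - r) = r ^+ n - r ^+ (n + k).
  elim: k => [|k IH]; first by rewrite addn0 big_geq // mul0r subrr.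
  rewrite addnS big_nat_recr ?leq_addr //= mulrDl IH exprS.
  ring.
by rewrite gerBl exprn_ge0.
Qed.

Context {X : completeNormedModType R[i]}.

(** At [n = 0] the rate bounds the sum itself; this later bounds the solution of the difference
    equation. *)
Lemma series_rate (g : nat -> X) C r :
    0 <= C -> 0 <= r < 1 -> (forall k, rnorm (g k) <= C * r ^+ k) ->
  exists l, forall n,
    rnorm (l - \sum_(0 <= k < n) g k) <= C / (1 - r) * r ^+ n.
Proof.
move=> C0 r01 gC; apply: cauchy_rate; last exact: geometric_small.
move=> n m nm; rewrite (@big_cat_nat _ _ _ n) //= addrAC subrr add0r.
apply: (le_trans (@rnorm_sum R X _ _ _)).
apply: (@le_trans _ _ (\sum_(n <= i < m) C * r ^+ i)).
  by apply: ler_sum => i _; exact: gC.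
rewrite -mulr_sumr -mulrA ler_wpM2l // mulrC -(subnKC nm).
exact: geometric_tail.
Qed.

End GeometricSeries.

(** * Real inner product, Riesz representation and adjoints *)

Section RealDot.
Context {R : realType} {X : completeNormedModType R[i]}.
Variable ip : {dot X for (@Num.conj R[i])}.
Hypothesis hip : norm_from_inner_product ip.
Implicit Types (x y z : X) (r : R).

Definition rdot x y : R := complex.Re (ip x y).

Lemma ipC x y : ip x y = (ip y x)^*.
Proof. by have := @hermitian_subproof _ _ _ _ ip x y; rewrite expr0 mul1r. Qed.

Lemma ipZl a x y : ip (a *: x) y = a * ip x y.
Proof. exact: linearZl_LR. Qed.

Lemma ipZr a x y : ip x (a *: y) = a^* * ip x y.
Proof. by rewrite ipC ipZl [ip x y]ipC; exact: (rmorphM (@conjc R)). Qed.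

Lemma ipDl x y z : ip (x + y) z = ip x z + ip y z.
Proof. exact: linearDl. Qed.

Lemma rdotC x y : rdot x y = rdot y x.
Proof.
by rewrite /rdot ipC; case: (ip y x).
Qed.

Lemma rdotDl x y z : rdot (x + y) z = rdot x z + rdot y z.
Proof. by rewrite /rdot ipDl raddfD. Qed.

Lemma rdotNl x z : rdot (- x) z = - rdot x z.
Proof. by rewrite /rdot linearNl raddfN. Qed.

Lemma rdotBl x y z : rdot (x - y) z = rdot x z - rdot y z.
Proof. by rewrite rdotDl rdotNl. Qed.

Lemma rdotZl r x z : rdot (r%:C *: x) z = r * rdot x z.
Proof. rewrite /rdot ipZl; case: (ip x z) => a b /=.
ring.
Qed.

Lemma rdotDr x y z : rdot z (x + y) = rdot z x + rdot z y.
Proof. by rewrite !(rdotC z) rdotDl. Qed.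

Lemma rdotNr x z : rdot z (- x) = - rdot z x.
Proof. by rewrite !(rdotC z) rdotNl. Qed.

Lemma rdotBr x y z : rdot z (x - y) = rdot z x - rdot z y.
Proof. by rewrite !(rdotC z) rdotBl. Qed.

Lemma rdotZr r x z : rdot z (r%:C *: x) = r * rdot z x.
Proof. by rewrite !(rdotC z) rdotZl. Qed.

Lemma rdot0l x : rdot 0 x = 0.
Proof. by rewrite -(subrr x) rdotBl subrr. Qed.

Lemma rdotxx x : rdot x x = rnorm x ^+ 2.
Proof. by rewrite /rdot -hip rnormE -rmorphXn. Qed.

(** Cauchy-Schwarz, obtained by squaring the triangle inequality and expanding. *)
Lemma rdot_le x y : rdot x y <= rnorm x * rnorm y.
Proof.
have := rnormD x y; rewrite -(@ler_pXn2r _ 2) ?nnegrE ?addr_ge0 ?rnorm_ge0 //.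
rewrite -rdotxx !(rdotDl, rdotDr) (rdotC y x) !rdotxx; lra.
Qed.

Lemma rdot_ge x y : - (rnorm x * rnorm y) <= rdot x y.
Proof. by rewrite lerNl -rdotNl -(rnormN x) rdot_le. Qed.

(** The multiple [w = 1] gives the real parts, and [w = 'i] the imaginary parts up to sign. *)
Lemma ip_rdotP x y z t :
  (forall w, rdot (w *: x) y = rdot (w *: z) t) -> ip x y = ip z t.
Proof.
move=> h; have := h 1; have := h 'i.
rewrite !scale1r /rdot !ipZl.
case: (ip x y) (ip z t) => a b [c d] /= h1 h2.
by congr (_ +i* _); move: h1 h2; lra.
Qed.

(* Minimise [rnorm x ^+ 2 / 2 - f x]: by the parallelogram law a minimising
   sequence is Cauchy, and the Euler equation at its limit is the claim. *)
Lemma riesz (f : X -> R) (M : R) :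
    (forall x y, f (x + y) = f x + f y) ->
    (forall r x, f (r%:C *: x) = r * f x) ->
    (forall x, f x <= M * rnorm x) ->
  exists z, forall x, f x = rdot x z.
Proof.
move=> fD fZ fM; pose J x := rnorm x ^+ 2 / 2 - f x.
have J_ge x : - (M ^+ 2 / 2) <= J x.
  by have := fM x; have := sqr_ge0 (rnorm x - M); rewrite /J; nra.
have hJ : has_inf (range J).
  split; first by exists (J 0); exists 0.
  by exists (- (M ^+ 2 / 2)) => _ [x _ <-].
set m := inf (range J).
have m_le x : m <= J x.
  by apply: ge_inf; [exact: hJ.2 | exists x].
have fN x : f (- x) = - f x.
  by have := fZ (-1) x; rewrite rmorphN rmorph1 scaleN1r mulN1r.
have par x y : rnorm (x - y) ^+ 2 <= 4 * (J x - m + (J y - m)).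
  have := m_le ((2^-1 : R)%:C *: (x + y)).
  rewrite /J fZ fD -!rdotxx !(rdotZl, rdotZr) !(rdotDl, rdotDr) !(rdotNl, rdotNr).
  rewrite (rdotC y x); lra.
(* The gap is a square because [par] bounds squared distances. *)
have hx n : exists x, J x - m < 2^-1 ^+ n.+1 ^+ 2.
  have e0 : 0 < 2^-1 ^+ n.+1 ^+ 2 :> R by rewrite !exprn_gt0 // invr_gt0.
  have [_ [x _ <-] xm] := inf_adherent e0 hJ.
  by exists x; rewrite ltrBlDl.
have [u uP] := choice hx.
have q01 : 0 <= (2^-1 : R) < 1 by apply/andP; split; lra.
have qle n k : (n <= k)%N -> 2^-1 ^+ k.+1 ^+ 2 <= 2^-1 ^+ n.+1 ^+ 2 :> R.
  move=> nk; rewrite ler_pXn2r ?nnegrE ?exprn_ge0 ?invr_ge0 //.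
  by apply: ler_wiXn2l => //; lra.
have [z zP] : exists z, forall n, rnorm (z - u n) <= 2 * 2^-1 ^+ n.
  apply: cauchy_rate => [n k nk|]; last exact: geometric_small.
  rewrite -(@ler_pXn2r _ 2) ?nnegrE ?rnorm_ge0 ?mulr_ge0 ?exprn_ge0 ?invr_ge0//.
  apply: (le_trans (par _ _)).
  have := ltW (uP n); have := ltW (uP k); have := qle _ _ nk.
  rewrite !exprS; set q := _ ^+ n; nra.
exists z => x.
(* Both sides are odd in [y], so one inequality suffices. *)
suff E y : f y <= rdot y z.
  by apply/eqP; rewrite eq_le E /= -lerN2 -fN -rdotNl; exact: E.
apply/ler_addgt0Pr => eps eps0.
(* Write [s = 2^-n]. Comparing [J] at [u n] and [u n + s y], then dividing by [s], costs at most
   [s (|y|^2 / 2 + 1)]; replacing [u n] by [z] costs [2 s |y|]. *)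
have [n ne] := geometric_small _ (rnorm y ^+ 2 / 2 + 1 + 2 * rnorm y) q01 _ eps0.
apply: (le_trans _ (lerD (lexx _) (ltW ne))).
have s0 : 0 < 2^-1 ^+ n :> R by rewrite exprn_gt0 // invr_gt0.
have := m_le (u n + (2^-1 ^+ n)%:C *: y); have := ltW (uP n); have := zP n.
have := rdot_ge y (z - u n); rewrite rdotBr.
have := rnorm_ge0 y.
rewrite /J fD fZ -!rdotxx !(rdotDl, rdotDr) !(rdotZl, rdotZr) (rdotC y (u n)).
rewrite (exprS _ n).
set s := 2^-1 ^+ n in s0 *; set D := rdot y y; set N := rnorm y.
set d := rnorm (z - u n); set U := rdot (u n) (u n); set V := rdot (u n) y.
move=> N0 h1 h2 h3 h4.
have h5 : s * (f y - V) <= s * (s * (D / 2 + 1)) by nra.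
rewrite ler_pM2l // in h5.
have h6 : N * d <= N * (2 * s) by rewrite ler_wpM2l.
move: h1 h5 h6; lra.
Qed.

Lemma rdot_eq z t : (forall x, rdot z x = rdot t x) -> z = t.
Proof.
move=> h; apply/eqP; rewrite -subr_eq0; apply/eqP/rnorm0_eq0.
by apply/eqP; rewrite -sqrf_eq0 -rdotxx rdotBl h subrr.
Qed.

(** Riesz is applied to the real functional [rdot (T x) y]; complex linearity of [T] upgrades the
    real identity to one for [ip]. *)
Lemma adjointP (T : {linear X -> X}) (M : R) :
  (forall x, rnorm (T x) <= M * rnorm x) ->
  forall x y, ip (T x) y = ip x (adjoint ip T y).
Proof.
move=> TM x y; rewrite /adjoint.
suff /(xgetPex 0)/(_ x) : exists z, forall x, ip (T x) y = ip x z by [].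
have [] := @riesz (fun x => rdot (T x) y) (M * rnorm y).
- by move=> u v; rewrite linearD rdotDl.
- by move=> r u; rewrite linearZ rdotZl.
- move=> u; apply: (le_trans (rdot_le _ _)).
  by rewrite mulrAC ler_wpM2r // rnorm_ge0.
move=> z zP; exists z => u; apply: ip_rdotP => w.
by rewrite -linearZ zP.
Qed.

Section Adjoint.
Variables (T : {linear X -> X}) (M : R).
Hypothesis TM : forall x, rnorm (T x) <= M * rnorm x.

Lemma adjoint_rdot x y : rdot (T x) y = rdot x (adjoint ip T y).
Proof. by rewrite /rdot (adjointP _ _ TM). Qed.

Lemma adjoint_linear : linear (adjoint ip T).
Proof.
have flip x y : ip y (T x) = ip (adjoint ip T y) x.
  by rewrite ipC (adjointP _ _ TM) [RHS]ipC.
move=> a y z; apply: rdot_eq => x.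
by rewrite /rdot -flip !(ipDl, ipZl) -!flip.
Qed.

(** With [z] the adjoint applied to [y], [|z|^2 = <T z, y> <= M |z| |y|], and one divides by [|z|]
    when it is nonzero. *)
Lemma adjoint_bound y : rnorm (adjoint ip T y) <= M * rnorm y.
Proof.
have [->|y0] := eqVneq (rnorm (adjoint ip T y)) 0.
  exact: le_trans (rnorm_ge0 _) (TM y).
have {}y0 : 0 < rnorm (adjoint ip T y) by rewrite lt_def y0 rnorm_ge0.
rewrite -(ler_pM2l y0) -expr2 -rdotxx -adjoint_rdot.
apply: (le_trans (rdot_le _ _)); rewrite mulrA ler_wpM2r ?rnorm_ge0 //.
by rewrite mulrC.
Qed.

End Adjoint.

(** Adjoints reverse products, so a right inverse of [T] becomes a left inverse of its adjoint. *)
Lemma adjointK (T Ti : {linear X -> X}) (M : R) :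
  (forall x, rnorm (T x) <= M * rnorm x) ->
  (forall x, rnorm (Ti x) <= M * rnorm x) ->
  cancel Ti T -> cancel (adjoint ip T) (adjoint ip Ti).
Proof.
move=> TM TiM TK y; apply: rdot_eq => x.
by rewrite ![rdot _ x]rdotC -(adjoint_rdot _ _ TiM) -(adjoint_rdot _ _ TM) TK.
Qed.

End RealDot.

(** * Bounded operators and integer powers *)

Section Operators.
Context {R : realType} {X : completeNormedModType R[i]}.
Implicit Types (x : X) (T S : X -> X).

Lemma bounded_operatorP T : bounded_operator T ->
  exists T' : {linear X -> X}, T = T' /\
    exists M : R, forall x, rnorm (T x) <= M * rnorm x.
Proof.
move=> [Tl [M TM]].
pose T' : {linear X -> X} :=
  HB.pack T (@GRing.isLinear.Build _ _ _ _ T Tl).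
exists T'; split => //; exists (complex.Re M) => x.
have := TM x; rewrite !rnormE lecE => /andP[_] /=.
by case: M {TM} => a b /=; rewrite mulr0 subr0.
Qed.

Lemma bounded_operatorI (T : {linear X -> X}) (M : R) :
  (forall x, rnorm (T x) <= M * rnorm x) -> bounded_operator T.
Proof.
move=> TM; split; first exact: linearP.
by exists M%:C => x; rewrite !rnormE -rmorphM lecR.
Qed.

Lemma opinvE T S : cancel T S -> cancel S T -> opinv T = S.
Proof.
move=> TS ST; apply/funext => y; rewrite -{1}(ST y) /opinv pinvKV ?inE //.
by move=> a b _ _; exact: can_inj TS _ _.
Qed.

Lemma opowS T S : cancel T S -> cancel S T ->
  forall (n : int) x, opow T (n + 1) x = T (opow T n x).
Proof.
(* Three cases: [n >= 0], the passage from -1 to 0 between the two branches of [opow], and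
   [n <= -2]. *)
move=> TS ST; have oE := opinvE _ _ TS ST; case=> [n|[|n]] x.
- by rewrite -PoszD addn1.
- by rewrite /= oE ST.
- have -> : Negz n.+1 + 1 = Negz n by rewrite !NegzE; lia.
  by rewrite /= oE ST.
Qed.

End Operators.

(** * Points of the unit circle and roots of unity *)

Section Cis.
Context {R : realType}.
Implicit Types s t : R.

Definition cis t : R[i] := cos t +i* sin t.

Lemma cisD s t : cis (s + t) = cis s * cis t.
Proof. by rewrite /cis cosD sinD; congr (_ +i* _); ring. Qed.

Lemma cis0 : cis 0 = 1.
Proof. by rewrite /cis cos0 sin0. Qed.

Lemma cisMn t n : cis (t *+ n) = cis t ^+ n.
Proof. by elim: n => [|n IH]; rewrite ?cis0 // mulrS cisD IH exprS. Qed.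

Lemma conjc_cis t : Num.conj (cis t) = cis (- t).
Proof. by rewrite /cis cosN sinN. Qed.

Lemma cis_2piMn n : cis (pi *+ 2 *+ n) = 1.
Proof. by rewrite cisMn /cis cos2pi sin2pi expr1n. Qed.

Lemma norm_cis t : `|cis t| = 1.
Proof. by rewrite normc_def /= cos2Dsin2 sqrtr1. Qed.

(** If [cos t = 1], the double-angle formula forces [sin (t / 2) = 0], but sine is positive between
    0 and [pi]. *)
Lemma cis_neq1 t : 0 < t < pi *+ 2 -> cis t != 1.
Proof.
move=> /andP[t0 t2]; apply/eqP => -[c1 _].
have : 0 < sin (t / 2) by apply: sin_gt0_pi; apply/andP; split; move: t2; lra.
have := cos_mulr2n (t / 2); have := cos2Dsin2 (t / 2).
have -> : (t / 2) *+ 2 = t by field.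
rewrite c1; nra.
Qed.

(** Orthogonality of characters: off the diagonal this is the geometric sum of an N-th root of unity
    other than 1. *)
Lemma cis_sum N (i k : 'I_N) :
  \sum_(j < N) cis (pi *+ 2 / N%:R * (i%:R - k%:R)) ^+ j =
  if i == k then N%:R else 0.
Proof.
have N0 : 0 < N%:R :> R by rewrite ltr0n (leq_ltn_trans _ (ltn_ord i)).
have [->|ik] := eqVneq i k.
  rewrite subrr mulr0 cis0; under eq_bigr do rewrite expr1n.
  by rewrite sumr_const card_ord.
set t := _ * _; have wN : cis t ^+ N = 1.
  (* Adding [k] full turns keeps all multiples natural, even if [i < k]. *)
  have tE : t *+ N + pi *+ 2 *+ k = pi *+ 2 *+ i.
    rewrite -(mulr_natr _ N) -(mulr_natr _ k) -(mulr_natr _ i) /t.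
    by field; rewrite lt0r_neq0.
  have : cis (t *+ N + pi *+ 2 *+ k) = 1.
    by rewrite tE cis_2piMn.
  by rewrite cisD cis_2piMn mulr1 cisMn.
have p0 : 0 < pi *+ 2 :> R by rewrite pmulrn_lgt0 // pi_gt0.
have w1 (a b : 'I_N) : (b < a)%N ->
    cis (pi *+ 2 / N%:R * (a%:R - b%:R) : R) != 1.
  move=> ba; apply: cis_neq1.
  have ba' : 0 < a%:R - b%:R :> R by rewrite subr_gt0 ltr_nat.
  have aN : a%:R - b%:R < N%:R :> R.
    by rewrite ltrBlDr (@lt_le_trans _ _ N%:R) ?ltr_nat // lerDl.
  by rewrite !mulr_gt0 ?invr_gt0 //= mulrAC ltr_pdivrMr // ltr_pM2l.
have {}w1 : cis t != 1.
  have [ki|ki|/val_inj e] := ltngtP k i; first exact: w1.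
    (* For [i < k] the angle is negative; its opposite lies in the range of [cis_neq1]. *)
    apply: contra (w1 _ _ ki) => /eqP c1; apply/eqP.
    rewrite -[LHS]mulr1 -[X in _ * X]c1 -cisD /t -mulrDr.
    by rewrite addrA subrK subrr mulr0 cis0.
  by rewrite e eqxx in ik.
have /eqP := subrX1 (cis t) N; rewrite wN subrr eq_sym mulf_eq0 subr_eq0.
by rewrite (negPf w1) => /eqP.
Qed.

End Cis.

(** * Discrete Fourier transform of vector-valued sequences *)

Section Fourier.
Context {R : realType} {X : completeNormedModType R[i]}.
Variable ip : {dot X for (@Num.conj R[i])}.
Hypothesis hip : norm_from_inner_product ip.

Lemma rdot_suml (I : finType) (F : I -> X) x :
  rdot ip (\sum_i F i) x = \sum_i rdot ip (F i) x.
Proof.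
exact: (big_morph (fun y => rdot ip y x) (fun y z => rdotDl ip y z x) (rdot0l ip x)).
Qed.

Lemma rdot_sumr (I : finType) (F : I -> X) x :
  rdot ip x (\sum_i F i) = \sum_i rdot ip x (F i).
Proof.
by rewrite rdotC rdot_suml; apply: eq_bigr => i _; rewrite rdotC.
Qed.

Lemma rdotZ_cis s t x y :
  rdot ip (cis s *: x) (cis t *: y) = rdot ip (cis (s - t) *: x) y.
Proof.
by rewrite /rdot !ipZl ipZr conjc_cis mulrA -cisD.
Qed.

Definition dft N (y : nat -> X) (j : nat) : X :=
  \sum_(i < N) cis (pi *+ 2 / N%:R * i%:R * j%:R) *: y i.

(** Expanding the squares and summing over frequencies first kills the off-diagonal terms; the
    factor [N] appears because [dft] is not normalised. *)
Lemma parseval N (y : nat -> X) :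
  \sum_(j < N) rnorm (dft N y j) ^+ 2 = N%:R * \sum_(i < N) rnorm (y i) ^+ 2.
Proof.
under eq_bigr do rewrite -(rdotxx _ hip) rdot_suml.
rewrite exchange_big mulr_sumr; apply: eq_bigr => i _ /=.
under eq_bigr do rewrite rdot_sumr.
rewrite exchange_big /= (bigD1 i) //= [X in _ + X]big1 ?addr0 => [|k ki].
  under eq_bigr do rewrite rdotZ_cis subrr cis0 scale1r (rdotxx _ hip).
  by rewrite sumr_const card_ord mulr_natl.
pose w : R := pi *+ 2 / N%:R * (i%:R - k%:R).
have E (j : 'I_N) : cis (pi *+ 2 / N%:R * i%:R * j%:R - pi *+ 2 / N%:R * k%:R * j%:R) = cis w ^+ j.
  by rewrite -cisMn -(mulr_natr w) /w; congr cis; ring.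
under eq_bigr do rewrite rdotZ_cis E.
rewrite -rdot_suml -scaler_suml cis_sum eq_sym (negPf ki) scale0r.
exact: rdot0l.
Qed.

Lemma dft_shift N (y : nat -> X) j : y N = y 0 -> (0 < N)%N ->
  dft N (fun i => y i.+1) j = cis (- (pi *+ 2 / N%:R * j%:R)) *: dft N y j.
Proof.
move=> yN N0; rewrite /dft scaler_sumr.
have N0' : N%:R != 0 :> R by rewrite pnatr_eq0 -lt0n.
pose F i := cis (pi *+ 2 / N%:R * i%:R * j%:R - pi *+ 2 / N%:R * j%:R) *: y i.
transitivity (\sum_(i < N) F i.+1).
  apply: eq_bigr => i _; congr (cis _ *: _); rewrite -natr1; ring.
transitivity (\sum_(i < N) F i); last first.
  by apply: eq_bigr => i _; rewrite scalerA -cisD /F; congr (cis _ *: _); ring.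
(* The wrap-around term: from index 0 to [N] the phase makes [j] full turns. *)
have FN : F N = F 0%N.
  rewrite /F yN; congr (_ *: _).
  by rewrite mulfVK // mulr0 mul0r sub0r cisD mulr_natr cis_2piMn mul1r.
apply: (addrI (F 0%N)); rewrite [RHS]addrC -FN.
transitivity (\sum_(i < N.+1) F i); first by rewrite big_ord_recl FN.
by rewrite big_ord_recr.
Qed.

(** [S] commutes with the transform, so frequency [j] sees [cis (- t) - S] at [t = 2 pi j / N];
    Parseval is used on both sides. *)
Lemma dft_bound (S : {linear X -> X}) (c : R) N (y : nat -> X) :
    (forall t x, 0 <= t <= pi *+ 2 ->
      c * rnorm x <= rnorm (cis (- t) *: x - S x)) ->
    0 <= c -> y N = y 0 ->
  c ^+ 2 * \sum_(i < N) rnorm (y i) ^+ 2 <=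
  \sum_(i < N) rnorm (y i.+1 - S (y i)) ^+ 2.
Proof.
move=> cS c0 yN; case: (posnP N) => [->|N0]; first by rewrite !big_ord0 mulr0.
have N0' : 0 < N%:R :> R by rewrite ltr0n.
rewrite -(ler_pM2l N0') mulrCA -!parseval mulr_sumr.
rewrite -(parseval N (fun i => y i.+1 - S (y i))).
apply: ler_sum => j _.
have -> : dft N (fun i => y i.+1 - S (y i)) j =
    cis (- (pi *+ 2 / N%:R * j%:R)) *: dft N y j - S (dft N y j).
  rewrite -dft_shift // /dft linear_sum -sumrB; apply: eq_bigr => i _.
  by rewrite scalerBr [in RHS]linearZ.

rewrite -exprMn ler_pXn2r ?nnegrE ?mulr_ge0 ?rnorm_ge0 //; apply: cS.
have p0 : 0 < pi *+ 2 :> R by rewrite pmulrn_lgt0 // pi_gt0.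
rewrite !mulr_ge0 ?invr_ge0 ?(ltW p0) //= mulrAC ler_pdivrMr // ler_pM2l //.
by rewrite ler_nat ltnW.
Qed.

End Fourier.

(** * Uniform bounds on the circle and exponential growth *)

Section Expansive.
Context {R : realType} {X : completeNormedModType R[i]}.
Variable ip : {dot X for (@Num.conj R[i])}.
Hypothesis hip : norm_from_inner_product ip.
Implicit Types (x : X) (c : R).

Lemma norm_Complex_le (a b : R) : complex.Re `|a +i* b| <= `|a| + `|b|.
Proof.
rewrite normc_def /= -(@ler_pXn2r _ 2) ?nnegrE ?addr_ge0 ?sqrtr_ge0 //.
rewrite sqr_sqrtr ?addr_ge0 ?sqr_ge0 // sqrrD !real_normK ?num_real //.
by rewrite lerD2r lerDl mulrn_wge0 // mulr_ge0.
Qed.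

Lemma uniform_circle_bound (S : X -> X) :
    (forall l : R[i], `|l| = 1 ->
      exists2 c : R, 0 < c & forall x, c * rnorm x <= rnorm (l *: x - S x)) ->
  exists2 c : R, 0 < c & forall t x, 0 <= t <= pi *+ 2 ->
    c * rnorm x <= rnorm (cis (- t) *: x - S x).
Proof.
move=> hS.
have /compact_near_coveringP cK := @segment_compact R 0 (pi *+ 2).
pose P (c t : R) := forall x, c * rnorm x <= rnorm (cis (- t) *: x - S x).
have : \forall c \near 0^'+, `[0, pi *+ 2]%classic `<=` P c.
  apply: cK => t _; have [a a0 aP] := hS (cis (- t)) (norm_cis _).
  have a4 : 0 < a / 4 by rewrite divr_gt0.
  have a2 : 0 < a / 2 by rewrite divr_gt0.
  have cost : \forall s \near t, `|cos t - cos s| < a / 4.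
    by move/cvgrPdist_lt: (@continuous_cos R t); apply.
  have sint : \forall s \near t, `|sin t - sin s| < a / 4.
    by move/cvgrPdist_lt: (@continuous_sin R t); apply.
  (* Moving cosine and sine by less than [a / 4] each moves the point by less than [a / 2], which
     leaves a lower bound [a / 2]. *)
  exists ([set s | `|cos t - cos s| < a / 4 /\ `|sin t - sin s| < a / 4],
          [set c | c < a / 2]).
    by split; [exact: filterI | exact: nbhs_right_lt].
  move=> [s c] /= [[hc hs] ca] x.
  have := aP x; have := rnormD (cis (- s) *: x - S x) ((cis (- t) - cis (- s)) *: x).
  rewrite scalerBl addrC addrA subrK -scalerBl rnormZ.
  have -> : cis (- t) - cis (- s) = (cos t - cos s) +i* (sin s - sin t).
    by rewrite /cis !cosN !sinN; congr (_ +i* _); ring.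
  have := norm_Complex_le (cos t - cos s) (sin s - sin t); rewrite (distrC (sin s)).
  have := rnorm_ge0 x; nra.
move=> near_c; have [c [c0 cP]] := filter_ex (filterI (nbhs_right_gt (0 : R)) near_c).
by exists c => // t x t2; apply: cP; rewrite /= in_itv.
Qed.

Lemma two_sided_growth (S Si : {linear X -> X}) (M c : R) :
    cancel S Si -> cancel Si S -> 1 <= M -> 0 <= c ->
    (forall x, rnorm (S x) <= M * rnorm x) ->
    (forall t x, 0 <= t <= pi *+ 2 ->
      c * rnorm x <= rnorm (cis (- t) *: x - S x)) ->
  forall x p, let b k := rnorm (iter k S x) ^+ 2 + rnorm (iter k Si x) ^+ 2 in
    c ^+ 2 / 2 * \sum_(k < p.+1) b k <= M ^+ 2 * b p.+1.
Proof.
move=> SK SiK M1 c0 SM cS x p /=.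
have [m mE] : {m | m = p.+1} by exists p.+1.
have m0 : (0 < m)%N by rewrite mE.
rewrite -mE.
have iterK n z : iter n S (iter n Si z) = z.
  by elim: n z => // n IH z; rewrite iterSr iterS SiK IH.
(* The cut-off orbit, re-indexed by naturals: [y i] is [S^(i - m) x] for [0 < i < 2m], and [y]
   vanishes at both ends 0 and [2m]. *)
pose x' := iter m Si x.
pose y i := if (0 < i < m + m)%N then iter i S x' else 0.
have y_ge k : (k < m)%N -> y (m + k)%N = iter k S x.
  by move=> km; rewrite /y ltn_add2l km addn_gt0 m0 /= (addnC m k) iterD iterK.
have y_le k : (k < m)%N -> y (m - k)%N = iter k Si x.
  move=> km; rewrite /y subn_gt0 km (leq_ltn_trans (leq_subr _ _)) /=; last first.
    by rewrite -addn1 leq_add2l.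
  by rewrite /x' -{2}(subnK (ltnW km)) iterD iterK.
have := dft_bound _ hip S c (m + m) y cS c0.
rewrite {1}/y ltnn andbF {1}/y ltnn /= => /(_ erefl).
have E1 : \sum_(i < m + m) rnorm (y i) ^+ 2 =
    \sum_(i < p) rnorm (iter i.+1 Si x) ^+ 2 +
    \sum_(i < m) rnorm (iter i S x) ^+ 2.
  rewrite big_split_ord /=; congr (_ + _); last first.
    by apply: eq_bigr => i _; rewrite y_ge.
  rewrite (reindex_inj rev_ord_inj) /=.
  pose G i := rnorm (y (m - i.+1)%N) ^+ 2.
  have Gp : G p = 0 by rewrite /G -mE subnn /y /= rnorm0 expr0n.
  have GE (i : 'I_p) : G i = rnorm (iter i.+1 Si x) ^+ 2.
    by rewrite /G y_le // mE ltnS.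
  transitivity (\sum_(i < m) G i) => //.
  rewrite mE big_ord_recr /= Gp addr0.
  by apply: eq_bigr => i _; exact: GE.
(* Inside the window [y] is an exact orbit; only the entry at [i = 0] and the exit at [i = 2m - 1]
   contribute. *)
have E2 : \sum_(i < m + m) rnorm (y i.+1 - S (y i)) ^+ 2 =
    rnorm (iter p Si x) ^+ 2 + rnorm (iter m S x) ^+ 2.
  pose W i := rnorm (y i.+1 - S (y i)) ^+ 2.
  have W0 : W 0%N = rnorm (iter p Si x) ^+ 2.
    rewrite /W {2}/y linear0 subr0 -(y_le p) ?mE // subSnn.
    by congr (rnorm (y _) ^+ 2).
  have Wm : W (p + p).+1 = rnorm (iter m S x) ^+ 2.
    have -> : (p + p).+1 = (m + p)%N by rewrite mE.
    rewrite /W y_ge ?mE // -addnS -mE {1}/y ltnn andbF sub0r rnormN.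
    by rewrite mE.
  have WE i : (i < p + p)%N -> W i.+1 = 0.
    move=> ip'; have h1 : (0 < i.+1 < m + m)%N by lia.
    have h2 : (0 < i.+2 < m + m)%N by lia.
    rewrite /W /y h1 h2.
    by rewrite subrr rnorm0 expr0n.
  transitivity (\sum_(i < m + m) W i) => //.
  have -> : (m + m)%N = (p + p).+2 by rewrite mE addSn addnS.
  rewrite big_ord_recl big_ord_recr /= W0 Wm big1 ?add0r // => i _.
  by rewrite WE.
have E3 : \sum_(i < m) rnorm (iter i Si x) ^+ 2 =
    rnorm x ^+ 2 + \sum_(i < p) rnorm (iter i.+1 Si x) ^+ 2.
  by rewrite mE big_ord_recl.
(* The term [b 0] counts [x] twice, the orbit only once; absorbing the extra copy costs the factor 2
   in [c ^+ 2 / 2]. *)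
have E4 : rnorm x ^+ 2 <= \sum_(i < m) rnorm (iter i S x) ^+ 2.
  by rewrite mE big_ord_recl lerDl sumr_ge0 // => i _; rewrite sqr_ge0.
have E5 : rnorm (iter p Si x) ^+ 2 <= M ^+ 2 * rnorm (iter m Si x) ^+ 2.
  have M0 : 0 <= M by exact: le_trans M1.
  rewrite -exprMn ler_pXn2r ?nnegrE ?mulr_ge0 ?rnorm_ge0 //.
  by rewrite mE iterS -{1}(SiK (iter p Si x)).
have E6 : rnorm (iter m S x) ^+ 2 <= M ^+ 2 * rnorm (iter m S x) ^+ 2.
  by rewrite ler_peMl ?sqr_ge0 // exprn_ege1.
rewrite E1 E2 big_split /= E3 => h.
have := sqr_ge0 c; move: h E4 E5 E6.
set s1 := \sum_(i < p) _; set s2 := \sum_(i < m) _ => h E4 E5 E6 c2.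
have s1_ge0 : 0 <= s1 by apply: sumr_ge0 => i _; rewrite sqr_ge0.
rewrite -[S (iter p S x)]iterS -[Si (iter p Si x)]iterS -mE.
have := mulr_ge0 c2 s1_ge0; have := ler_wpM2l c2 E4; lra.
Qed.

(** Partial sums grow at least by the factor [1 + k]. The index [p] is chosen before [b], so that
    the exponent in expansivity will not depend on the vector. *)
Lemma exponential_growth (k B D : R) : 0 < k -> 0 < B ->
  exists p, forall b : nat -> R, b 0%N = B ->
    (forall p, k * \sum_(i < p.+1) b i <= b p.+1) -> D <= b p.+1.
Proof.
move=> k0 B0.
have k1 : 0 <= 1 + k by rewrite addr_ge0 // ltW.
have q01 : 0 <= (1 + k)^-1 < 1.
  by rewrite invr_ge0 invf_lt1 ?ltrDl ?addr_gt0 // k0 k1.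
have [p] := geometric_small _ D q01 _ (mulr_gt0 k0 B0).
rewrite exprVn ltr_pdivrMr ?exprn_gt0 ?addr_gt0 // -mulrA => /ltW h.
exists p => b b0 bk.
have A n : B * (1 + k) ^+ n <= \sum_(i < n.+1) b i.
  elim: n => [|n IH]; first by rewrite expr0 mulr1 big_ord1 b0.
  rewrite big_ord_recr /= exprS; apply: le_trans (lerD (lexx _) (bk n)).
  by have := ler_wpM2l k1 IH; lra.
by apply: (le_trans h); apply: (le_trans _ (bk p)); rewrite ler_pM2l.
Qed.

End Expansive.

(** * Lower bounds on the circle from expansivity and from shadowing *)

Section Circle.
Context {R : realType} {X : completeNormedModType R[i]}.
Variable ip : {dot X for (@Num.conj R[i])}.
Hypothesis hip : norm_from_inner_product ip.
Implicit Types (x y : X) (l : R[i]).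

Lemma bounded_below_unit (S : {linear X -> X}) l (c : R) :
    (forall x, rnorm x = 1 -> c <= rnorm (l *: x - S x)) ->
  forall x, c * rnorm x <= rnorm (l *: x - S x).
Proof.
move=> h x; have [x0|x0] := eqVneq (rnorm x) 0.
  by rewrite x0 mulr0 rnorm_ge0.
have {}x0 : 0 < rnorm x by rewrite lt_def x0 rnorm_ge0.
have x1 : rnorm ((rnorm x)^-1%:C *: x) = 1.
  by rewrite rnormZr ger0_norm ?invr_ge0 ?rnorm_ge0 // mulVf ?lt0r_neq0.
have := h _ x1.
rewrite [S _]linearZ scalerA mulrC -scalerA -scalerBr rnormZr.
rewrite ger0_norm ?invr_ge0 ?rnorm_ge0 // mulrC ler_pdivlMr //.
Qed.

(** Each of the [k] steps adds one defect [S x - l *: x], amplified at most by [M ^+ k]. *)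
Lemma iter_approx (S : {linear X -> X}) (M : R) l x k :
    `|l| = 1 -> 1 <= M -> (forall x, rnorm (S x) <= M * rnorm x) ->
  rnorm (iter k S x - l ^+ k *: x) <= k%:R * M ^+ k * rnorm (S x - l *: x).
Proof.
move=> l1 M1 SM; elim: k => [|k IH].
  by rewrite expr0 scale1r subrr rnorm0 !mul0r.
have -> : iter k.+1 S x - l ^+ k.+1 *: x =
    S (iter k S x - l ^+ k *: x) + l ^+ k *: (S x - l *: x).
  by rewrite linearB [in S (_ *: _)]linearZ scalerBr scalerA exprSr addrA subrK.
apply: (le_trans (rnormD _ _)).
rewrite [rnorm (l ^+ k *: _)]rnormZ1 ?normrX ?l1 ?expr1n //.
have := SM (iter k S x - l ^+ k *: x); have := rnorm_ge0 (S x - l *: x).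
have : 1 <= M ^+ k.+1 by rewrite exprn_ege1.
move: IH; rewrite -(natr1 k) exprS.
set a := rnorm _; set b := rnorm _; set d := rnorm _; set Mk := M ^+ k.
move=> IH Mk1 d0 bM; have M0 : 0 <= M by lra.
have := ler_wpM2l M0 IH; have := ler_wpM2r d0 Mk1; lra.
Qed.

(** A unit vector with [S x] close to [l *: x] also has [Si x] close to [l^-1 *: x], so neither n-th
    iterate can reach norm 2. *)
Lemma expansive_circle (S Si : {linear X -> X}) (M : R) n :
    cancel S Si -> 1 <= M ->
    (forall x, rnorm (S x) <= M * rnorm x) ->
    (forall x, rnorm (Si x) <= M * rnorm x) ->
    (forall x, rnorm x = 1 ->
       2 <= rnorm (iter n S x) \/ 2 <= rnorm (iter n Si x)) ->
  forall l, `|l| = 1 ->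
    exists2 c : R, 0 < c & forall x, c * rnorm x <= rnorm (l *: x - S x).
Proof.
move=> SK M1 SM SiM ex l l1; have M0 : 0 <= M by lra.
have K0 : 0 <= n%:R * M ^+ n * M by rewrite !mulr_ge0 // exprn_ge0.
(* With [d] the defect, both iterates have norm at most [1 + n M^n M d]; the added 1 makes the
   denominator positive. *)
exists (n%:R * M ^+ n * M + 1)^-1; first by rewrite invr_gt0 ltr_wpDl.
apply: bounded_below_unit => x x1.
have l0 : l != 0 by rewrite -normr_eq0 l1 oner_eq0.
have lV1 : `|l^-1| = 1 by rewrite normfV l1 invr1.
have near_iter (A : {linear X -> X}) (m : R[i]) : `|m| = 1 ->
    (forall x, rnorm (A x) <= M * rnorm x) ->
    rnorm (iter n A x) <= 1 + n%:R * M ^+ n * rnorm (A x - m *: x).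
  move=> m1 AM; apply: (le_trans _ (lerD (lexx _) (iter_approx _ _ _ _ n m1 M1 AM))).
  have := rnormD (m ^+ n *: x) (iter n A x - m ^+ n *: x).
  by rewrite rnormZ1 ?normrX ?m1 ?expr1n // x1 addrC subrK.
have d0 := rnorm_ge0 (l *: x - S x).
have := near_iter S l l1 SM; have := near_iter Si l^-1 lV1 SiM.
have -> : Si x - l^-1 *: x = l^-1 *: Si (l *: x - S x).
  by rewrite linearB SK [Si (_ *: _)]linearZ scalerBr scalerA mulVf // scale1r.
rewrite rnormZ1 // -(rnormN (S x - _)) opprB.
have := SiM (l *: x - S x); set d := rnorm (l *: x - S x) in d0 *.
have nM : 0 <= n%:R * M ^+ n by rewrite mulr_ge0 // exprn_ge0.
move=> h1; have := ler_wpM2l nM h1 => h2 h3 h4.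
rewrite -[X in X <= _]mul1r ler_pdivrMr ?ltr_wpDl //.
have := mulr_ge0 nM d0; have := ler_wpM2r (mulr_ge0 nM d0) M1.
by case: (ex x x1); lra.
Qed.

Lemma shadowing_circle (T S : {linear X -> X}) (P : int -> X -> X) (delta : R) :
    (forall x y, rdot ip (T x) y = rdot ip x (S y)) ->
    (forall n x, P (n + 1) x = T (P n x)) ->
    0 < delta ->
    (forall x : int -> X, (forall n, rnorm (x (n + 1) - T (x n)) <= delta) ->
      exists y, forall n, rnorm (x n - P n y) <= 1) ->
  forall l, `|l| = 1 -> forall x, delta * rnorm x <= rnorm (l *: x - S x).
Proof.
move=> TS PS d0 sh l l1; apply: bounded_below_unit => y y1.
have l0 : l != 0 by rewrite -normr_eq0 l1 oner_eq0.
have lV1 n : `|l^-1 ^+ n| = 1 by rewrite normrX normfV l1 invr1 expr1n.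
pose z n : X := delta%:C *: (l^-1 ^+ n.+1 *: y).
pose xs := fix xs n := if n is k.+1 then T (xs k) + z k else 0.
pose x (n : int) := if n is Posz k then xs k else 0.
have [n|w wP] := sh x.
  case: n => [n|[|n]].
  - rewrite -PoszD addn1 /= addrC addKr rnormZr rnormZ1 // y1 mulr1.
    by rewrite ger0_norm // ltW.
  - by rewrite /= linear0 subr0 rnorm0 ltW.
  - have -> : Negz n.+1 + 1 = Negz n by rewrite !NegzE; lia.
    by rewrite /= linear0 subr0 rnorm0 ltW.
pose u (n : nat) := x n - P n w.
have uS n : u n.+1 = T (u n) + z n.
  by rewrite /u -addn1 PoszD PS /= addn1 linearB addrAC.
(* The component of the error along the rotating unit vector stays in [[-1, 1]] by shadowing. *)
pose q n := rdot ip (u n) (l^-1 ^+ n *: y).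
have q_le n : q n <= 1.
  apply: (le_trans (rdot_le _ hip _ _)).
  by rewrite rnormZ1 // y1 mulr1; exact: wP.
have q_ge n : -1 <= q n.
  apply: (le_trans _ (rdot_ge _ hip _ _)).
  by rewrite rnormZ1 // y1 mulr1 lerN2; exact: wP.
set eta := rnorm _.
(* The forcing adds exactly [delta]; replacing [S y] by [l *: y] loses at most [eta], as [u n] has
   norm at most 1. *)
have qS n : q n + (delta - eta) <= q n.+1.
  rewrite {2}/q uS rdotDl TS.
  have -> : S (l^-1 ^+ n.+1 *: y) = l^-1 ^+ n *: y + l^-1 ^+ n.+1 *: (S y - l *: y).
    have lE : l^-1 ^+ n.+1 * l = l^-1 ^+ n by rewrite exprSr mulfVK.
    by rewrite linearZ scalerBr scalerA lE addrC subrK.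
  rewrite rdotDr /z rdotZl (rdotxx _ hip) rnormZ1 // y1 expr1n mulr1.
  have := rdot_ge _ hip (u n) (l^-1 ^+ n.+1 *: (S y - l *: y)).
  rewrite rnormZ1 // -(rnormN (S y - _)) opprB -/eta -/(q n).
  have := ler_wpM2r (rnorm_ge0 (l *: y - S y)) (wP n); rewrite -/eta mul1r.
  rewrite -/(u n); lra.
have qn n : q 0%N + n%:R * (delta - eta) <= q n.
  elim: n => [|n IH]; first by rewrite mul0r addr0.
  by apply: le_trans (qS n); rewrite -natr1; move: IH; lra.
rewrite leNgt; apply/negP => ed.
have ed' : 0 < delta - eta by lra.
have := archi_boundP (ltW (divr_gt0 (ltr0Sn R 2) ed')).
rewrite ltr_pdivrMr //; set n := Num.bound _ => nb.
have := qn n; have := q_le n; have := q_ge 0%N; lra.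
Qed.

End Circle.

(** * Auxiliary estimates and sums over one period *)

Lemma linear_geometric_bound {R : realType} (q : R) : 0 <= q < 1 ->
  exists C r : R, [/\ 0 <= C, 0 <= r < 1 &
    forall k : nat, (2 * k).+1%:R * q ^+ k <= (C * r ^+ k) ^+ 2].
Proof.
move=> /andP[q0 q1]; pose h := (1 - q) / 2.
have h0 : 0 < h by rewrite /h; lra.
have qh0 : 0 <= q + h by lra.
have qh1 : q + h < 1 by rewrite /h; lra.
have D0 : 0 <= 1 + 2 / h by rewrite addr_ge0 // divr_ge0 // ltW.
(* A Bernoulli estimate gives [q^k (1 + k h) <= (q + h)^k], and [(1 + 2 / h) (1 + k h)] dominates
   [2k + 1]. The roots undo the square in the goal. *)
exists (Num.sqrt (1 + 2 / h)), (Num.sqrt (q + h)); split.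
- exact: sqrtr_ge0.
- by rewrite sqrtr_ge0 /= -(sqrtr1 R) ltr_sqrt.
move=> k; rewrite exprMn -exprM (mulnC k 2) exprM !sqr_sqrtr //.
have A : q ^+ k * (1 + k%:R * h) <= (q + h) ^+ k.
  elim: k => [|k IH]; first by rewrite !expr0 mul0r addr0 mulr1.
  rewrite !exprS; apply: (le_trans _ (ler_wpM2l qh0 IH)).
  have Q0 : 0 <= q ^+ k by rewrite exprn_ge0.
  rewrite -natr1; have k0 : 0 <= k%:R :> R by [].
  have := mulr_ge0 (mulr_ge0 Q0 k0) (sqr_ge0 h); have := mulr_ge0 Q0 (ltW h0).
  have : q * (q ^+ k * h) <= 1 * (q ^+ k * h).
    by rewrite ler_wpM2r ?(ltW q1) // mulr_ge0 // ltW.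
  rewrite expr2; lra.
apply: (le_trans _ (ler_wpM2l D0 A)); rewrite mulrCA mulrC ler_wpM2l ?exprn_ge0 //.
have -> : (1 + 2 / h) * (1 + k%:R * h) = 1 + 2 * k%:R + (k%:R * h + 2 / h).
  by field; rewrite lt0r_neq0.
have := divr_ge0 (ler0n R 2) (ltW h0); have := mulr_ge0 (ler0n R k) (ltW h0).
by rewrite -(natr1 (2 * k)) natrM; lra.
Qed.

Lemma modz_window (n m : int) (k : nat) : n - k%:Z <= m <= n + k%:Z ->
  n - k%:Z + ((m - (n - k%:Z)) %% (2 * k).+1%:Z)%Z = m.
Proof. by move=> hm; rewrite modz_small; lia. Qed.

Section Periodic.
Variables (V : zmodType) (p : nat).

Definition int_periodic {T : Type} (f : int -> T) := forall n : int, f (n + p.+1%:Z) = f n.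

(** The period [p.+1] is never zero; the start [a] is free so that any chosen index can be the first
    term. *)
Definition period_sum (a : int) (f : int -> V) := \sum_(i < p.+1) f (a + i%:Z).

Lemma period_sum_shift a (f : int -> V) : int_periodic f ->
  period_sum a (fun n => f (n + 1)) = period_sum a f.
Proof.
move=> fp; rewrite /period_sum; apply: (addrI (f a)).
transitivity (\sum_(i < p.+2) f (a + i%:Z)).
  rewrite [RHS]big_ord_recl /= addr0; congr (_ + _); apply: eq_bigr => i _.
  by congr f; rewrite /bump /=; lia.
by rewrite [LHS]big_ord_recr /= fp addrC.
Qed.

Lemma period_sum_shiftN a (f : int -> V) : int_periodic f ->
  period_sum a (fun n => f (n - 1)) = period_sum a f.
Proof.
move=> fp; rewrite -(period_sum_shift _ (fun n => f (n - 1))).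
  by apply: eq_bigr => i _; rewrite addrK.
by move=> n; rewrite addrAC fp.
Qed.

End Periodic.

(** * Bounded solutions of [u (n + 1) - T (u n) = z n] *)

Section Solve.
Context {R : realType} {X : completeNormedModType R[i]}.
Variable ip : {dot X for (@Num.conj R[i])}.
Hypothesis hip : norm_from_inner_product ip.
Variables (T S : {linear X -> X}) (M c : R).
Hypothesis TS : forall x y, rdot ip (T x) y = rdot ip x (S y).
Hypothesis M0 : 0 <= M.
Hypothesis TM : forall x, rnorm (T x) <= M * rnorm x.
Hypothesis SM : forall x, rnorm (S x) <= M * rnorm x.
Hypothesis c01 : 0 < c <= 1.
Hypothesis cS : forall t x, 0 <= t <= pi *+ 2 ->
  c * rnorm x <= rnorm (cis (- t) *: x - S x).
Implicit Types (v w z : int -> X) (n a : int) (p k : nat).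

Definition shiftA w n : X := w (n + 1) - T (w n).
Definition shiftB v n : X := v (n - 1) - S (v n).

Local Notation sumsq := (fun p a v => period_sum R p a (fun n => rnorm (v n) ^+ 2)).

(** Reversing time turns [v (n - 1) - S (v n)] into the form treated by [dft_bound]. *)
Lemma shiftB_bound p a v : int_periodic p v ->
  c ^+ 2 * sumsq p a v <= sumsq p a (shiftB v).
Proof.
move=> vp; pose y i := v (a + p%:Z - i%:Z).
have c0 : 0 <= c by case/andP: c01 => /ltW.
have yp : y p.+1 = y 0%N.
  by rewrite /y subr0 -(vp (_ - _)) subrK.
have := dft_bound _ hip S c p.+1 y cS c0 yp.
congr (_ * _ <= _); rewrite (reindex_inj rev_ord_inj) /=; apply: eq_bigr => i _.
  by congr (rnorm (v _) ^+ 2); have := ltn_ord i; lia.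
rewrite /shiftB /y; congr (rnorm (v _ - S (v _)) ^+ 2); have := ltn_ord i; lia.
Qed.

Lemma shiftA_bound p a w : int_periodic p w ->
  sumsq p a (shiftA w) <= (2 + 2 * M ^+ 2) * sumsq p a w.
Proof.
move=> wp; rewrite mulrDl.
rewrite -{1}(period_sum_shift _ _ _ (fun n => rnorm (w n) ^+ 2)) => [|n]; last by rewrite wp.
rewrite /period_sum !mulr_sumr -big_split /=; apply: ler_sum => i _.
set n := a + _; have := rnormB (w (n + 1)) (T (w n)); have := TM (w n).
rewrite -/(shiftA w n); have := rnorm_ge0 (shiftA w n).
set x := rnorm (shiftA _ _); set y := rnorm (w (n + 1)); set u := rnorm (T _).
set d := rnorm (w n) => x0 ud xyu.
have y0 : 0 <= y by exact: rnorm_ge0.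
have d0 : 0 <= d by exact: rnorm_ge0.
have Md := mulr_ge0 M0 d0.
have xyd : x <= y + M * d by lra.
have : x ^+ 2 <= (y + M * d) ^+ 2 by rewrite ler_pXn2r ?nnegrE ?addr_ge0.
have := sqr_ge0 (y - M * d); rewrite !expr2; lra.
Qed.

(** Summation by parts; periodicity removes the boundary terms. *)
Lemma shift_adjoint p a v w : int_periodic p v -> int_periodic p w ->
  period_sum R p a (fun n => rdot ip (v n) (shiftA w n)) =
  period_sum R p a (fun n => rdot ip (shiftB v n) (w n)).
Proof.
move=> vp wp.
transitivity (period_sum R p a (fun n => rdot ip (v n) (w (n + 1))) -
  period_sum R p a (fun n => rdot ip (S (v n)) (w n))).
  rewrite /period_sum -sumrB; apply: eq_bigr => i _.
  by rewrite rdotBr [rdot ip (S _) _]rdotC -TS [rdot ip (T _) _]rdotC.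
rewrite -(period_sum_shiftN _ _ _ (fun n => rdot ip (v n) (w (n + 1)))) => [|n].
  by rewrite /period_sum -sumrB; apply: eq_bigr => i _; rewrite subrK rdotBl.
by rewrite vp addrAC wp.
Qed.

(* The inverse of the bound on the squared norm of [shiftA]. *)
Definition step : R := (2 + 2 * M ^+ 2)^-1.

Definition relax v n : X := v n - step%:C *: shiftA (shiftB v) n.

(** With [t = step], [|v - t A B v|^2 = |v|^2 - 2 t |B v|^2 + t^2 |A B v|^2]. The choice of [t]
    bounds the last term by [t |B v|^2], and [shiftB_bound] concludes. *)
Lemma relax_contraction p a v : int_periodic p v ->
  sumsq p a (relax v) <= (1 - step * c ^+ 2) * sumsq p a v.
Proof.
move=> vp.
have L0 : 0 < 2 + 2 * M ^+ 2 by rewrite ltr_pwDl // mulr_ge0 // sqr_ge0.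
have s0 : 0 < step by rewrite invr_gt0.
have Bp : int_periodic p (shiftB v) by move=> n; rewrite /shiftB addrAC !vp.
have E : sumsq p a (relax v) = sumsq p a v -
    2 * step * sumsq p a (shiftB v) + step ^+ 2 * sumsq p a (shiftA (shiftB v)).
  have -> : sumsq p a (shiftB v) =
      period_sum R p a (fun n => rdot ip (v n) (shiftA (shiftB v) n)).
    rewrite shift_adjoint //.
    by apply: eq_bigr => i _; rewrite rdotxx.
  rewrite /period_sum !mulr_sumr -sumrB -big_split /=; apply: eq_bigr => i _.
  rewrite -!(rdotxx _ hip) /relax.
  move: (shiftA _ _) (v _) => x y.
  rewrite rdotBr !rdotBl !rdotZr !rdotZl (rdotC _ x y).
  ring.
have := shiftA_bound _ a _ Bp; have := shiftB_bound _ a _ vp.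
move: E => /= ->.
set x := period_sum _ _ _ _; set y := period_sum _ _ _ _; set u := period_sum _ _ _ _.
move=> h1 h2.
have h3 : step * u <= y by rewrite /step mulrC ler_pdivrMr // mulrC.
have := ler_wpM2l (ltW s0) h3; have := ler_wpM2l (ltW s0) h1; rewrite expr2; lra.
Qed.

Lemma relax_periodic p v : int_periodic p v -> int_periodic p (relax v).
Proof.
by move=> vp n; rewrite /relax /shiftA /shiftB -!(addrAC _ _ p.+1%:Z) !vp.
Qed.

Lemma relax_local k v w n :
    (forall m, n - k%:Z <= m <= n + k%:Z -> v m = w m) ->
  iter k relax v n = iter k relax w n.
Proof.
elim: k v w n => [|k IH] v w n vw.
  by apply: vw; lia.
have E m : n - 1 <= m <= n + 1 -> iter k relax v m = iter k relax w m.
  by move=> hm; apply: IH => j hj; apply: vw; lia.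
rewrite !iterS /relax /shiftA /shiftB !E //; lia.
Qed.

Lemma relax_decay : exists C r : R, [/\ 0 <= C, 0 <= r < 1 &
  forall (delta : R) z, 0 <= delta -> (forall n, rnorm (z n) <= delta) ->
    forall k n, rnorm (iter k relax z n) <= C * r ^+ k * delta].
Proof.
have [c0 c1] : 0 < c /\ c <= 1 by case/andP: c01.
have L2 : 1 <= 2 + 2 * M ^+ 2 by have := sqr_ge0 M; lra.
have s0 : 0 < step by rewrite invr_gt0 (lt_le_trans ltr01).
have s1 : step <= 1 by rewrite invf_le1 // (lt_le_trans ltr01).
have sc0 : 0 < step * c ^+ 2 by rewrite mulr_gt0 // exprn_gt0.
have sc1 : step * c ^+ 2 <= 1 by rewrite mulr_ile1 ?exprn_ile1 // ?sqr_ge0 // ltW.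
have q01 : 0 <= 1 - step * c ^+ 2 < 1 by apply/andP; split; lra.
have [C [r [C0 r01 Cr]]] := linear_geometric_bound _ q01.
exists C, r; split => // delta z d0 zd k n.
have r0 : 0 <= r by case/andP: r01.
pose p := (2 * k)%N.
(* A bounded [z] need not be square-summable: it is replaced by the sequence of period [2k + 1]
   agreeing with it on the window that [k] steps can see. *)
pose w (m : int) := z (n - k%:Z + ((m - (n - k%:Z)) %% p.+1%:Z)%Z).
have wp : int_periodic p w by move=> m; rewrite /w (addrAC m) modzDr.
have -> : iter k relax z n = iter k relax w n.
  by apply: relax_local => m hm; rewrite /w modz_window.
have iter_bound j : int_periodic p (iter j relax w) /\
    sumsq p n (iter j relax w) <= (1 - step * c ^+ 2) ^+ j * (p.+1%:R * delta ^+ 2).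
  elim: j => [|j [jp IH]].
    split => //; rewrite expr0 mul1r /period_sum.
    have -> : p.+1%:R * delta ^+ 2 = \sum_(i < p.+1) delta ^+ 2.
      by rewrite sumr_const card_ord mulr_natl.
    apply: ler_sum => i _.
    by rewrite ler_pXn2r ?nnegrE ?rnorm_ge0 //; exact: zd.
  split; first exact: relax_periodic.
  rewrite iterS exprS -mulrA; apply: (le_trans (relax_contraction _ _ _ jp)).
  by rewrite ler_wpM2l //; case/andP: q01.
have [_ h] := iter_bound k.
have Crd : 0 <= C * r ^+ k * delta by rewrite !mulr_ge0 // exprn_ge0.
rewrite -(@ler_pXn2r _ 2) ?nnegrE ?rnorm_ge0 // [X in _ <= X]exprMn.
apply: (le_trans _ (ler_wpM2r (sqr_ge0 delta) (Cr k))).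
(* The value at [n] is the first term of the period sum. *)
apply: (@le_trans _ _ (sumsq p n (iter k relax w))).
  by rewrite /= /period_sum big_ord_recl addr0 lerDl sumr_ge0 // => i _; exact: sqr_ge0.
by apply: (le_trans h); rewrite mulrA [_ ^+ k * _]mulrC.
Qed.

Lemma shift_solvable : exists2 K : R, 0 <= K &
  forall (delta : R) z, 0 <= delta -> (forall n, rnorm (z n) <= delta) ->
    exists2 u : int -> X, (forall n, u (n + 1) - T (u n) = z n) &
      forall n, rnorm (u n) <= K * delta.
Proof.
have [C [r [C0 r01 dec]]] := relax_decay.
have [r0 r1] : 0 <= r /\ r < 1 by case/andP: r01.
have L2 : 0 < 2 + 2 * M ^+ 2 by have := sqr_ge0 M; lra.
have s0 : 0 < step by rewrite invr_gt0.
(* The factor [1 + M] bounds [shiftB] in the supremum norm. *)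
pose D := step * ((1 + M) * C).
have D0 : 0 <= D by rewrite !mulr_ge0 ?addr_ge0 // ltW.
exists (D / (1 - r)); first by rewrite divr_ge0 // subr_ge0 ltW.
move=> delta z d0 zd.
pose g n k := step%:C *: shiftB (iter k relax z) n.
have gD n k : rnorm (g n k) <= D * delta * r ^+ k.
  rewrite /g rnormZr gtr0_norm // /D -!mulrA ler_wpM2l ?(ltW s0) //.
  apply: (le_trans (rnormB (iter k relax z (n - 1)) (S (iter k relax z n)))).
  have h1 := dec _ _ d0 zd k (n - 1); have h2 := dec _ _ d0 zd k n.
  have h3 := SM (iter k relax z n); have h4 := ler_wpM2l M0 h2; lra.
have /choice[u uP] : forall n, exists l, forall k,
    rnorm (l - \sum_(0 <= j < k) g n j) <= D * delta / (1 - r) * r ^+ k.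
  by move=> n; apply: series_rate => //; rewrite mulr_ge0.
exists u => n; last first.
  by have := uP n 0%N; rewrite big_geq // subr0 expr0 mulr1 mulrAC.
apply/eqP; rewrite -subr_eq0; apply/eqP/rnorm0_eq0/eqP.
rewrite eq_le rnorm_ge0 andbT.
apply/ler_addgt0Pr => eps eps0; rewrite add0r.
(* The residual consists of truncation errors at [n + 1] and [n], giving [1 + M], and of the k-th
   relaxed term, giving [C * delta]. *)
have [k hk] := geometric_small _ ((1 + M) * (D * delta / (1 - r)) + C * delta) r01 _ eps0.
apply: (le_trans _ (ltW hk)).
pose U m := \sum_(0 <= j < k) g m j.
(* Since [t A B = 1 - Q], the partial sums telescope to [z - Q^k z]. *)
have AU : U (n + 1) - T (U n) = z n - iter k relax z n.
  rewrite /U; elim: k {hk U} => [|k IH].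
    by rewrite !big_geq // linear0 !subrr.
  rewrite !big_nat_recr //= linearD opprD addrACA IH.
  rewrite /g [T (_ *: _)]linearZ -scalerBr.
  have -> : relax (iter k relax z) n = iter k relax z n -
      step%:C *: shiftA (shiftB (iter k relax z)) n by [].
  by rewrite opprB -addrA; congr (_ + _); rewrite addrC.
have -> : u (n + 1) - T (u n) - z n =
    (u (n + 1) - U (n + 1)) - T (u n - U n) - iter k relax z n.
  have -> : iter k relax z n = z n - (U (n + 1) - T (U n)).
    by rewrite AU opprB addrC subrK.
  rewrite linearB !opprB addrA; congr (_ - z n).
  rewrite [u _ - _ + _]addrC -[RHS]addrA [u _ - _ + _]addrA subrK.
  by rewrite [RHS]addrC addrA subrK.
apply: (le_trans (rnormB _ _)); apply: (le_trans (lerD (rnormB _ _) (lexx _))).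
have h1 := uP (n + 1) k; have h2 := uP n k; have h3 := dec _ _ d0 zd k n.
have := ler_wpM2l M0 h2; have := TM (u n - U n); rewrite -/(U n) -/(U (n + 1)) in h1 *.
lra.
Qed.

End Solve.

(** * Reduction of the three properties to lower bounds on the circle *)

Section Characterization.
Context {R : realType} {X : completeNormedModType R[i]}.
Variable ip : {dot X for (@Num.conj R[i])}.
Hypothesis hip : norm_from_inner_product ip.
Implicit Types (x y : X) (l : R[i]).

Definition below_on_circle (S : X -> X) : Prop := forall l, `|l| = 1 ->
  exists2 c : R, 0 < c & forall x, c * rnorm x <= rnorm (l *: x - S x).

Lemma real_gt0 (a : R[i]) : 0 < a -> exists2 r : R, 0 < r & a = r%:C.
Proof.
move=> a0; have aE : (complex.Re a)%:C = a by rewrite RRe_real ?gtr0_real.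
by exists (complex.Re a); rewrite // -ltcR aE.
Qed.

Lemma realC_gt0 (r : R) : 0 < r -> 0 < r%:C :> R[i].
Proof. by move=> r0; rewrite (_ : 0 = 0%:C) // ltcR. Qed.

Lemma le2_norm x : (2 <= `|x|) = (2 <= rnorm x).
Proof. by rewrite rnormE -lecR rmorph_nat. Qed.

Lemma bounded_belowP (A : X -> X) : bounded_below A <->
  exists2 c : R, 0 < c & forall x, c * rnorm x <= rnorm (A x).
Proof.
split=> [[a /real_gt0[c c0 ->] cA]|[c c0 cA]].
  by exists c => // x; have := cA x; rewrite !rnormE -rmorphM lecR.
by exists c%:C; [exact: realC_gt0 | move=> x; rewrite !rnormE -rmorphM lecR].
Qed.

Lemma invertible_bounded_below (A : X -> X) : invertible A -> bounded_below A.
Proof.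
move=> [B [/bounded_operatorP[B' [-> [M BM]]] AB _]].
apply/bounded_belowP; exists (`|M| + 1)^-1; first by rewrite invr_gt0 ltr_wpDl.
move=> x; rewrite mulrC ler_pdivrMr ?ltr_wpDl // -{1}(AB x) mulrC.
apply: (le_trans (BM _)); rewrite ler_wpM2r ?rnorm_ge0 //.
by have := ler_norm M; lra.
Qed.

Lemma approx_point_spectrum_circle (S : X -> X) :
  approx_point_spectrum S `&` @unit_circle R[i] = set0 <-> below_on_circle S.
Proof.
split=> [h l l1|h].
  apply/bounded_belowP; apply: contrapT => nb.
  have : set0 l by rewrite -h; split=> //; split=> // /invertible_bounded_below.
  by [].
apply/seteqP; split=> // l [[_ nb] l1]; apply: nb.
by apply/bounded_belowP; exact: h.
Qed.

(** Injectivity carries the equality backwards in time. *)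
Lemma trajectory_unique (T : X -> X) (f g : int -> X) : injective T ->
    (forall n, f (n + 1) = T (f n)) -> (forall n, g (n + 1) = T (g n)) ->
    f 0 = g 0 -> f =1 g.
Proof.
move=> Tinj fT gT fg; elim/int_rec => [//|n IH|n IH].
  by rewrite -addn1 PoszD fT gT IH.
apply: Tinj; rewrite -fT -gT.
by have -> : - n.+1%:Z + 1 = - n%:Z by lia.
Qed.

Section Invertible.
Variables (S Si : {linear X -> X}) (M : R).
Hypotheses (SK : cancel S Si) (SiK : cancel Si S) (M1 : 1 <= M).
Hypothesis SM : forall x, rnorm (S x) <= M * rnorm x.
Hypothesis SiM : forall x, rnorm (Si x) <= M * rnorm x.

Lemma opow_neg n x : opow S (- n%:Z) x = iter n Si x.
Proof. by case: n => [//|n]; rewrite /= (opinvE _ _ SK SiK). Qed.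

Lemma uniformly_expansive_circle :
  uniformly_expansive S <-> below_on_circle S.
Proof.
split=> [[_ [n n0 ex]]|h].
  apply: (expansive_circle _ _ _ n SK M1 SM SiM) => x x1.
  by have := ex x; rewrite !le2_norm opow_neg rnormE x1; exact.
split.
  by exists Si; split=> //; exact: bounded_operatorI SiM.
have [c c0 cS] := uniform_circle_bound _ h.
have M0 : 0 < M by apply: lt_le_trans M1.
pose k := c ^+ 2 / 2 / M ^+ 2.
have k0 : 0 < k by rewrite !divr_gt0 // exprn_gt0.
(* For a unit vector [b 0 = 2]; once [b] reaches [8 = 2^2 + 2^2], one of the two norms is at least
   2. *)
have [p hp] := exponential_growth k 2 8 k0 (ltr0Sn R 1).
exists p.+1 => // x; rewrite rnormE => -[x1].
rewrite !le2_norm opow_neg.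
pose b n := rnorm (iter n S x) ^+ 2 + rnorm (iter n Si x) ^+ 2.
have : 8 <= b p.+1.
  apply: hp => [|n]; first by rewrite /b /= x1 expr1n.
  rewrite /k [_ * \sum_(_ < _) _]mulrAC ler_pdivrMr ?exprn_gt0 // [leRHS]mulrC.
  exact: (two_sided_growth _ hip _ _ _ _ SK SiK M1 (ltW c0) SM cS).
rewrite /b => b8; have [h1|h1] := leP 2 (rnorm (iter p.+1 S x)); first by left.
right; rewrite leNgt; apply/negP => h2; move: b8.
have := rnorm_ge0 (iter p.+1 S x); have := rnorm_ge0 (iter p.+1 Si x).
move: h1 h2; rewrite !expr2; set u := rnorm _; set v := rnorm _; nra.
Qed.

End Invertible.

Section Shadowing.
Variables (T Ti S : {linear X -> X}) (M : R).
Hypotheses (TK : cancel T Ti) (TiK : cancel Ti T) (M0 : 0 <= M).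
Hypothesis TM : forall x, rnorm (T x) <= M * rnorm x.
Hypothesis SM : forall x, rnorm (S x) <= M * rnorm x.
Hypothesis TS : forall x y, rdot ip (T x) y = rdot ip x (S y).

Lemma shadowing_property_circle : shadowing_property T <-> below_on_circle S.
Proof.
have PS := opowS _ _ TK TiK.
split=> [sh l l1|h].
  have [_ /real_gt0[d d0 ->] dP] := sh 1 ltr01.
  exists d => //; apply: (shadowing_circle _ hip _ _ _ _ TS PS d0) => // x xd.
  have [|y yP] := dP x; first by move=> n; rewrite rnormE lecR; exact: xd.
  by exists y => n; have := yP n; rewrite rnormE lecR.
have [c c0 cS] := uniform_circle_bound _ h.
(* The constant is capped at 1, as [shift_solvable] requires. *)
have m01 : 0 < Num.min c 1 <= 1 by rewrite lt_min c0 ltr01 ge_min lexx orbT.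
have mS t x : 0 <= t <= pi *+ 2 ->
    Num.min c 1 * rnorm x <= rnorm (cis (- t) *: x - S x).
  move=> t2; apply: le_trans (cS _ x t2).
  by rewrite ler_wpM2r ?rnorm_ge0 // ge_min lexx.
have [K K0 KP] := shift_solvable _ hip _ _ _ _ TS M0 TM SM m01 mS.
move=> _ /real_gt0[e e0 ->]; exists (e / (K + 1))%:C.
  by apply: realC_gt0; rewrite divr_gt0 // ltr_wpDl.
move=> x xP; pose z n := x (n + 1) - T (x n).
have d0 : 0 <= e / (K + 1) by rewrite divr_ge0 ?addr_ge0 // ltW.
have [n|u uz uK] := KP _ z d0; first by have := xP n; rewrite rnormE lecR.
(* Subtracting the bounded solution [u] driven by the errors [z] leaves an exact trajectory, at
   distance at most [K * delta <= e] from [x]. *)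
exists (x 0 - u 0) => n.
have step m : x (m + 1) - u (m + 1) = T (x m - u m).
  have -> : x (m + 1) = z m + T (x m) by rewrite subrK.
  have -> : u (m + 1) = z m + T (u m) by rewrite -uz subrK.
  by rewrite linearB opprD addrACA subrr add0r.
have xu := trajectory_unique _ _ _ (can_inj TK) step
  (fun m => PS m (x 0 - u 0)) erefl.
rewrite -[opow T n _]xu opprB addrC subrK rnormE lecR.
apply: (le_trans (uK n)); rewrite mulrA ler_pdivrMr ?ltr_wpDl //.
by rewrite mulrDr mulr1 mulrC lerDl ltW.
Qed.

End Shadowing.

End Characterization.

(* Shadowing, expansivity of the adjoint and its approximate point spectrum *)
Local Close Scope complex_scope.

Theorem theorem1p8 (R : realType) (X : completeNormedModType R[i])
    (ip : {dot X for (@Num.conj R[i])}) (hip : norm_from_inner_product ip)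
    (T : X -> X) (hT : bounded_operator T) (hTinv : invertible T) :
  (shadowing_property T <-> uniformly_expansive (adjoint ip T)) /\
  (uniformly_expansive (adjoint ip T) <->
     approx_point_spectrum (adjoint ip T) `&` @unit_circle R[i] = set0).
Proof.
have [Ti [hTi TK TiK]] := hTinv.
have [T' [ET [M1 TM1]]] := bounded_operatorP _ hT.
have [Ti' [ETi [M2 TiM2]]] := bounded_operatorP _ hTi.
move: TK TiK TM1 TiM2; rewrite ET ETi => TK TiK TM1 TiM2 {T Ti ET ETi hT hTi hTinv}.
(* One constant, at least 1, bounds both the operator and its inverse, hence both adjoints. *)
pose M := 1 + `|M1| + `|M2|.
have M_ge1 : 1 <= M by have := normr_ge0 M1; have := normr_ge0 M2; rewrite /M; lra.
have TM x : rnorm (T' x) <= M * rnorm x.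
  apply: (le_trans (TM1 x)); rewrite ler_wpM2r ?rnorm_ge0 //.
  by have := ler_norm M1; have := normr_ge0 M2; rewrite /M; lra.
have TiM x : rnorm (Ti' x) <= M * rnorm x.
  apply: (le_trans (TiM2 x)); rewrite ler_wpM2r ?rnorm_ge0 //.
  by have := ler_norm M2; have := normr_ge0 M1; rewrite /M; lra.
pose S : {linear X -> X} := HB.pack (adjoint ip T')
  (@GRing.isLinear.Build _ _ _ _ (adjoint ip T') (adjoint_linear _ hip _ _ TM)).
pose Si : {linear X -> X} := HB.pack (adjoint ip Ti')
  (@GRing.isLinear.Build _ _ _ _ (adjoint ip Ti') (adjoint_linear _ hip _ _ TiM)).
have SK : cancel S Si by exact: (adjointK _ hip _ _ _ TM TiM TiK).
have SiK : cancel Si S by exact: (adjointK _ hip _ _ _ TiM TM TK).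
have SM : forall x, rnorm (S x) <= M * rnorm x by exact: (adjoint_bound _ hip _ _ TM).
have SiM : forall x, rnorm (Si x) <= M * rnorm x by exact: (adjoint_bound _ hip _ _ TiM).
have TS : forall x y, rdot ip (T' x) y = rdot ip x (S y) by exact: (adjoint_rdot _ hip _ _ TM).
rewrite -[adjoint ip T']/(S : X -> X).
have M0 : 0 <= M by apply: le_trans M_ge1.
have := uniformly_expansive_circle _ hip _ _ _ SK SiK M_ge1 SM SiM.
have := shadowing_property_circle _ hip _ _ _ _ TK TiK M0 TM SM TS.
have := approx_point_spectrum_circle S.
tauto.
Qed.
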